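(* Let $n\ge 1$ and consider the operators on the algebra $\Lambda_n$ of symmetric polynomials in $x_1,\dots,x_n$ over $\mathbb{Q}$ $$D_+=\sum_{i=1}^n x_i^2\frac{\partial}{\partial x_i},\qquad D_0=2\sum_{i=1}^n x_i\frac{\partial}{\partial x_i},\qquad D_-=-\sum_{i=1}^n\frac{\partial}{\partial x_i}.$$ For every partition $\lambda\in\mathcal{Y}_n$, the Schur polynomial $\boldsymbol{s}_\lambda=\boldsymbol{s}_\lambda(x_1,\dots,x_n)$ satisfies $$\text{(i)}\quad D_-(\boldsymbol{s}_\lambda)=-\sum_{\mu=\lambda-\square\in\mathcal{Y}_n}(n+c(\square))\,\boldsymbol{s}_\mu,$$ $$\text{(ii)}\quad D_0(\boldsymbol{s}_\lambda)=2|\lambda|\,\boldsymbol{s}_\lambda,$$ $$\text{(iii)}\quad D_+(\boldsymbol{s}_\lambda)=\sum_{\mu=\lambda+\square\in\mathcal{Y}_n}c(\square)\,\boldsymbol{s}_\mu .$$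
   Context: $\mathcal{Y}_n$ is the set of partitions $\lambda=(\lambda_1\ge\cdots\ge\lambda_n\ge0)$ with at most $n$ nonzero parts, identified with Young diagrams with at most $n$ rows; $|\lambda|=\sum_i\lambda_i$. The Schur polynomial is $\boldsymbol{s}_\lambda=a_{\lambda+\delta}/a_\delta$, where $\delta=(n-1,n-2,\dots,1,0)$ and $a_\mu=\det(x_i^{\mu_j})_{1\le i,j\le n}$. The content of a cell $\square=(i,j)$ (row $i$, column $j$) is $c(\square)=j-i$. The sum over $\mu=\lambda-\square\in\mathcal{Y}_n$ (respectively $\mu=\lambda+\square\in\mathcal{Y}_n$) runs over all $\mu\in\mathcal{Y}_n$ whose Young diagram is obtained from that of $\lambda$ by removing (respectively adding) exactly one cell $\square$. *)

(* Defs.v *)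
From HB Require Import structures.
From mathcomp Require Import all_boot all_order all_fingroup all_algebra.
From mathcomp Require Import mpoly.

Set Implicit Arguments.
Unset Strict Implicit.
Unset Printing Implicit Defensive.

Import GRing.Theory.

Local Open Scope ring_scope.

Section Partitions.
Variable n : nat.

(* Trailing zeros are kept: lambda = (lambda_1 >= ... >= lambda_n >= 0).      *)
Record ypart := YPart { yval :> n.-tuple nat; ypartP : sorted geq yval }.

HB.instance Definition _ := [isSub for yval].
HB.instance Definition _ := [Countable of ypart by <:].

Implicit Types lam mu : ypart.

Definition psize lam : nat := \sum_(i < n) tnth lam i.

(* Cells are 0-based pairs (row, column); the content column - row does not   *)
(* depend on where the numbering starts.                                      *)
Definition cell : Type := (nat * nat)%type.

Definition cells lam : seq cell :=
  [seq (i, j) | i <- iota 0 n, j <- iota 0 (nth 0%N lam i)].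

Definition content (c : cell) : int := c.2%:Z - c.1%:Z.

(* The diagram of mu is that of lam together with the one further cell c.     *)
Definition adds lam (c : cell) mu : bool := perm_eq (cells mu) (c :: cells lam).

(* All partitions in Y_n with parts at most m; this only serves to make the   *)
(* sums below finite, see added_cellsP and removed_cellsP.                    *)
Definition box_parts (m : nat) : seq ypart :=
  pmap insub [seq map_tuple val t | t : n.-tuple 'I_m.+1].

(* The pairs (c, mu) with mu = lam + c, resp. mu = lam - c, each listed once. *)
Definition added_cells lam : seq (cell * ypart) :=
  [seq p <- [seq (c, mu) | mu <- box_parts (psize lam).+1, c <- cells mu]
     | adds lam p.1 p.2].

Definition removed_cells lam : seq (cell * ypart) :=
  [seq p <- [seq (c, mu) | mu <- box_parts (psize lam), c <- cells lam]
     | adds p.2 p.1 lam].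

Lemma size_cells lam : size (cells lam) = psize lam.
Proof.
rewrite size_allpairs_dep sumnE big_map -val_enum_ord big_map big_enum /=.
by apply: eq_bigr => i _; rewrite size_iota (tnth_nth 0%N).
Qed.

Lemma cells_uniq lam : uniq (cells lam).
Proof.
apply: allpairs_uniq_dep; first exact: iota_uniq.
  by move=> i _; apply: iota_uniq.
by move=> [i j] [i' j'] _ _ /= [-> ->].
Qed.

Lemma box_parts_uniq m : uniq (box_parts m).
Proof.
apply: (pmap_uniq (@insubK _ _ ypart)).
rewrite map_inj_uniq ?enum_uniq // => s t /(congr1 val) /= eq_st.
exact/val_inj/(inj_map val_inj eq_st).
Qed.

Lemma mem_box_parts m mu : (psize mu <= m)%N -> mu \in box_parts m.
Proof.
move=> le_m; rewrite mem_pmap_sub.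
have lt_m i : (tnth mu i < m.+1)%N.
  by rewrite ltnS (leq_trans _ le_m) // /psize (bigD1 i) //= leq_addr.
apply/imageP; exists [tuple Ordinal (lt_m i) | i < n] => //.
by apply: eq_from_tnth => i; rewrite !tnth_map tnth_ord_tuple.
Qed.

Lemma adds_psize lam c mu : adds lam c mu -> psize mu = (psize lam).+1.
Proof. by move/perm_size; rewrite /= !size_cells. Qed.

Lemma added_cellsP lam p : (p \in added_cells lam) = adds lam p.1 p.2.
Proof.
rewrite mem_filter; case: (boolP (adds _ _ _)) => //= add_p.
case: p => c mu /= in add_p *; apply/allpairsPdep; exists mu, c; split => //.
  by rewrite mem_box_parts // (adds_psize add_p).
by rewrite (perm_mem add_p) mem_head.
Qed.

Lemma removed_cellsP lam p : (p \in removed_cells lam) = adds p.2 p.1 lam.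
Proof.
rewrite mem_filter; case: (boolP (adds _ _ _)) => //= add_p.
case: p => c mu /= in add_p *; apply/allpairsPdep; exists mu, c; split => //.
  by rewrite mem_box_parts // (adds_psize add_p).
by rewrite (perm_mem add_p) mem_head.
Qed.

Lemma added_cells_uniq lam : uniq (added_cells lam).
Proof.
apply: filter_uniq; apply: allpairs_uniq_dep; first exact: box_parts_uniq.
  by move=> mu _; apply: cells_uniq.
by move=> [mu c] [mu' c'] _ _ /= [-> ->].
Qed.

Lemma removed_cells_uniq lam : uniq (removed_cells lam).
Proof.
apply: filter_uniq; apply: allpairs_uniq_dep; first exact: box_parts_uniq.
  by move=> mu _; apply: cells_uniq.
by move=> [mu c] [mu' c'] _ _ /= [-> ->].
Qed.

End Partitions.

(* Reduce each X^mu_j modulo prod_i (X - x_i) to a remainder of degree < n.   *)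
Lemma power_mx_factor (R : comNzRingType) (n : nat) (x : 'I_n -> R)
    (mu : 'I_n -> nat) :
  exists C : 'M[R]_n, \matrix_(i < n, j < n) (x i ^+ mu j)
    = (\matrix_(i < n, j < n) (x i ^+ (n - j.+1))) *m C.
Proof.
pose g : {poly R} := \prod_(i < n) ('X - (x i)%:P).
have g_monic : g \is monic by apply: monic_prod => i _; apply: monicXsubC.
have size_g : size g = n.+1.
  by rewrite /g -big_enum size_prod_XsubC size_enum_ord.
have [r size_r rE] : exists2 r : 'I_n -> {poly R},
    forall j, (size (r j) <= n)%N & forall i j, (r j).[x i] = x i ^+ mu j.
  exists (fun j => Pdiv.Ring.rmodp 'X^(mu j) g) => [j | i j].
    by rewrite -ltnS -size_g Pdiv.Ring.ltn_rmodpN0 // monic_neq0.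
  have := congr1 (horner ^~ (x i)) (Pdiv.RingMonic.rdivp_eq g_monic 'X^(mu j)).
  rewrite hornerXn => ->; rewrite hornerD hornerM
          [g.[_]]horner_prod (bigD1 i) //.
  by rewrite /= hornerXsubC subrr mul0r mulr0 add0r.
exists (\matrix_(k < n, j < n) (r j)`_(n - k.+1)).
apply/matrixP => i j; rewrite !mxE -rE (horner_coef_wide _ (size_r j)).
rewrite (reindex_inj rev_ord_inj) /=.
by apply: eq_bigr => k _; rewrite !mxE mulrC.
Qed.

Section SymmetricPolynomials.
Variable n : nat.

Record sympoly := SymPoly {
  sympol :> {mpoly rat[n]};
  sympolP : sympol \is symmetric
}.

HB.instance Definition _ := [isSub for sympol].
HB.instance Definition _ := [Choice of sympoly by <:].
HB.instance Definition _ := [SubChoice_isSubAlgebra of sympoly by <:].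
HB.instance Definition _ := [SubNzRing_isSubComNzRing of sympoly by <:].

(* sum_i x_i^k d/dx_i                                                         *)
Definition euler (k : nat) (p : {mpoly rat[n]}) : {mpoly rat[n]} :=
  \sum_(i < n) 'X_i ^+ k * p^`M(i).

Lemma msymXi (s : 'S_n) (i : 'I_n) : msym s ('X_i : {mpoly rat[n]}) = 'X_(s i).
Proof.
rewrite msymX; congr 'X_[_]; apply/mnmP => j; rewrite mnmE !mnm1E.
by rewrite -(inj_eq (@perm_inj _ s)) permKV.
Qed.

Lemma mderiv_msym (s : 'S_n) (i : 'I_n) (p : {mpoly rat[n]}) :
  (msym s p)^`M(s i) = msym s p^`M(i).
Proof.
elim/mpolyind: p => [|c m p _ _ IHp]; first by rewrite !raddf0.
rewrite !(mderivD, msymD) IHp !(msymZ, mderivZ); congr (_ + _).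
rewrite msymX !mderivX msymZ msymX mnmE permK.
congr (_ *: (_ *: 'X_[_])); apply/mnmP => j; rewrite !mnmE.
by rewrite -(inj_eq (@perm_inj _ s) i) permKV.
Qed.

Lemma euler_sym k (p : sympoly) : euler k p \is symmetric.
Proof.
apply/issymP => s; rewrite raddf_sum /= [RHS](reindex_perm s) /=.
apply: eq_bigr => i _; rewrite msymM rmorphXn /= msymXi -mderiv_msym.
by have /issymP -> := sympolP p.
Qed.

Definition Deuler k (p : sympoly) : sympoly := SymPoly (euler_sym k p).

Definition Dplus (p : sympoly) : sympoly := Deuler 2 p.
Definition Dzero (p : sympoly) : sympoly := 2%:R *: Deuler 1 p.
Definition Dminus (p : sympoly) : sympoly := - Deuler 0 p.

Lemma DplusE p : Dplus p = \sum_(i < n) 'X_i ^+ 2 * (sympol p)^`M(i)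
  :> {mpoly rat[n]}.
Proof. by []. Qed.

Lemma DzeroE p : Dzero p = 2%:R *: \sum_(i < n) 'X_i * (sympol p)^`M(i)
  :> {mpoly rat[n]}.
Proof. by []. Qed.

Lemma DminusE p : Dminus p = - \sum_(i < n) (sympol p)^`M(i)
  :> {mpoly rat[n]}.
Proof. by congr (- _); apply: eq_bigr => i _; rewrite expr0 mul1r. Qed.

Definition alternant (mu : 'I_n -> nat) : {mpoly rat[n]} :=
  \det (\matrix_(i < n, j < n) ('X_i ^+ mu j)).

Definition delta (j : 'I_n) : nat := n - j.+1.

Lemma msym_alternant (s : 'S_n) mu :
  msym s (alternant mu) = (-1) ^+ s * alternant mu.
Proof.
rewrite /alternant -det_map_mx -[(-1) ^+ s]det_perm -det_mulmx -row_permE.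
by congr (\det _); apply/matrixP => i j; rewrite !mxE rmorphXn /= msymXi.
Qed.

Lemma alternant_delta_neq0 : alternant delta != 0.
Proof.
pose a : 'rV[{mpoly rat[n]}]_n := \row_i 'X_i.
pose r := perm (@rev_ord_inj n).
have -> : alternant delta = (-1) ^+ r * \det (Vandermonde n a).
  rewrite -[(-1) ^+ r]det_perm -det_mulmx -row_permE /alternant -det_tr.
  by congr (\det _); apply/matrixP => i j; rewrite !mxE permE.
rewrite mulf_eq0 signr_eq0 det_Vandermonde.
apply/prodf_neq0 => i _; apply/prodf_neq0 => j lt_ij.
rewrite !mxE subr_eq0; apply/eqP => /(congr1 (fun p => p@_U_(j)%MM)).
rewrite !mcoeffX eqxx eq_mnm1.
have /negPf -> : i != j by rewrite -val_eqE neq_ltn lt_ij.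
by move/eqP; rewrite oner_eq0.
Qed.

Lemma alternant_dvd mu : exists q, q * alternant delta == alternant mu.
Proof.
have [C defC] := power_mx_factor (fun i => 'X_i : {mpoly rat[n]}) mu.
by exists (\det C); rewrite mulrC /alternant defC det_mulmx.
Qed.

(* The quotient a_(lambda + delta) / a_delta; it is polynomial and unique.    *)
Definition schur_pol (lam : ypart n) : {mpoly rat[n]} :=
  xchoose (alternant_dvd (fun j => tnth lam j + delta j)%N).

Lemma schur_polM (lam : ypart n) :
  schur_pol lam * alternant delta = alternant (fun j => tnth lam j + delta j)%N.
Proof. exact/eqP/(xchooseP (alternant_dvd _)). Qed.

Lemma schur_pol_unique (lam : ypart n) q :
  q * alternant delta = alternant (fun j => tnth lam j + delta j)%N ->
  q = schur_pol lam.
Proof. by rewrite -schur_polM => /(mulIf alternant_delta_neq0). Qed.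

Lemma schur_pol_sym lam : schur_pol lam \is symmetric.
Proof.
apply/issymP => s; apply: (mulIf alternant_delta_neq0).
apply: (@mulfI _ ((-1) ^+ s)); first by rewrite signr_eq0.
by rewrite mulrCA -msym_alternant -msymM !schur_polM msym_alternant.
Qed.

Definition schur (lam : ypart n) : sympoly := SymPoly (schur_pol_sym lam).

End SymmetricPolynomials.

(* Main.v *)
(* Each E_k = sum_i x_i^k d/dx_i is a derivation that acts on alternants by
   E_k a_mu = sum_j mu_j a_(mu + (k-1) e_j). Apply it to
   s_lambda a_delta = a_(lambda + delta) and use E_0 a_delta = 0,
   E_1 a_delta = |delta| a_delta and E_2 a_delta = (n-1) e_1 a_delta, where
   e_1 a_mu = sum_j a_(mu + e_j). A term a_(lambda + delta +- e_j) vanishes by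
   repeated columns unless lambda +- e_j is a partition, except for
   a_(delta + lambda - e_j) with j last and lambda_j = 0, whose coefficient
   is 0. *)
From HB Require Import structures.
Require Import Defs.
From mathcomp Require Import all_boot all_order all_fingroup all_algebra.
From mathcomp Require Import mpoly.
From mathcomp Require Import ring zify.

Import GRing.Theory.
Local Open Scope ring_scope.

(** * Row lengths, cells and the addition of one cell *)

Lemma ypart_anti n (lam : ypart n) (i j : 'I_n) :
  (i <= j)%N -> (tnth lam j <= tnth lam i)%N.
Proof.
move=> le_ij; rewrite !(tnth_nth 0%N).
have geq_trans : transitive geq by move=> a b c /= ba cb; apply: leq_trans cb ba.
apply: (sorted_leq_nth geq_trans leqnn 0%N (ypartP lam)) => //.
  by rewrite inE size_tuple.
by rewrite inE size_tuple.
Qed.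

Lemma ypart_exists n (f : 'I_n -> nat) :
  (forall i j : 'I_n, (i < j)%N -> (f j <= f i)%N) ->
  exists mu : ypart n, forall i, tnth mu i = f i.
Proof.
move=> f_anti.
suff f_sorted : sorted geq [tuple f i | i < n].
  by exists (YPart f_sorted) => i; rewrite tnth_mktuple.
apply/(sortedP 0%N) => k; rewrite size_tuple => lt_k.
have nthE (i : 'I_n) : nth 0%N [tuple f i | i < n] i = f i.
  by rewrite -tnth_nth tnth_mktuple.
have := f_anti (Ordinal (ltnW lt_k)) (Ordinal lt_k) (ltnSn k).
by rewrite -!nthE.
Qed.

Lemma mem_cells n (lam : ypart n) (i k : nat) :
  ((i, k) \in cells lam) = (k < nth 0 lam i)%N.
Proof.
apply/allpairsPdep/idP => [[a [b [_]]] | lt_k].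
  by rewrite mem_iota => /= lt_b [-> ->].
exists i, k; rewrite !mem_iota /=; split=> //.
by case: (ltnP i n) lt_k => // le_n; rewrite nth_default ?size_tuple.
Qed.

(** Passes from diagrams to row lengths: a set of cells that is again a diagram can only grow at the
    end of a row. *)
Lemma addsP n (lam mu : ypart n) (c : cell) :
  reflect (exists2 i : 'I_n, c = (i : nat, tnth lam i)
             & forall j, tnth mu j = (tnth lam j + (j == i))%N)
          (adds lam c mu).
Proof.
apply: (iffP idP) => [add_c | [i -> muE]].
  case: c add_c => a k add_c; have memE := perm_mem add_c.
  have := cells_uniq mu; rewrite (perm_uniq add_c) /= => /andP[].
  rewrite mem_cells -leqNgt => le_k _.
  have := memE (a, k); rewrite mem_head mem_cells => lt_k.
  have lt_a : (a < n)%N.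
    by case: (ltnP a n) lt_k => // le_n; rewrite nth_default ?size_tuple.
  pose i := Ordinal lt_a.
  have mu_ne (j : 'I_n) : j != i -> tnth mu j = tnth lam j.
    move=> ne_ji; apply/eqP; rewrite !(tnth_nth 0%N) eqn_leq.
    have E l : (l < nth 0 mu j)%N = (l < nth 0 lam j)%N.
      have := memE (j : nat, l); rewrite inE !mem_cells => ->.
      by rewrite xpair_eqE -[a]/(val i) val_eqE (negPf ne_ji).
    by rewrite leqNgt E ltnn leqNgt -E ltnn.
  (* The total size grows by one while the other rows agree, so row [i] takes the whole increase. *)
  have mu_i : tnth mu i = (tnth lam i).+1.
    have /eqP := adds_psize add_c; rewrite /psize (bigD1 i) //=.
    rewrite [X in _ == X.+1](bigD1 i) //= (eq_bigr _ mu_ne) -addSn eqn_add2r.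
    by move/eqP.
  exists i => [|j].
    (* The new cell lies outside [lam] and inside [mu], which leaves only column [tnth lam i]. *)
    move: mu_i; rewrite !(tnth_nth 0%N) => mu_i; congr (_, _).
    by apply/eqP; rewrite eqn_leq le_k andbT -ltnS -mu_i.
  by case: eqP => [-> | /eqP ne_ji]; rewrite ?addn1 ?addn0 // mu_ne.
apply: uniq_perm; first exact: cells_uniq.
  by rewrite /= cells_uniq mem_cells (tnth_nth 0%N) ltnn.
move=> [a k]; rewrite inE !mem_cells.
case: (ltnP a n) => [lt_a | le_n]; last first.
  rewrite !nth_default ?size_tuple // orbF xpair_eqE.
  by case: eqP => // a_i; rewrite a_i leqNgt ltn_ord in le_n.
have := muE (Ordinal lt_a); rewrite !(tnth_nth 0%N) /= => ->.
rewrite xpair_eqE -val_eqE /=; case: eqP => [-> | _] /=.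
  by rewrite addn1 ltnS leq_eqVlt.
by rewrite addn0.
Qed.

(** Used with [h] reading the row of a cell: each row carries at most one pair, and rows that carry
    none must contribute zero. *)
Lemma big_seq_image (V : nmodType) (T : eqType) (n : nat) (s : seq T)
    (h : T -> nat) (F : T -> V) (G : nat -> V) :
  uniq s -> {in s &, injective h} -> {in s, forall p, (h p < n)%N} ->
  {in s, forall p, F p = G (h p)} ->
  (forall j : 'I_n, G j != 0 -> exists2 p, p \in s & h p = j) ->
  \sum_(p <- s) F p = \sum_(j < n) G j.
Proof.
move=> s_uniq h_inj h_lt FG G_supp.
rewrite big_seq (eq_bigr (fun p => G (h p))); last by move=> p; apply: FG.
rewrite -big_seq -(big_map h xpredT G) -(big_mkord xpredT G).
rewrite [RHS](bigID (mem (map h s))) /= [X in _ + X]big1_seq ?addr0; last first.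
  move=> j /andP[/= nj]; rewrite mem_index_iota /= => lt_j.
  apply/eqP; apply: contraNT nj => /(G_supp (Ordinal lt_j)) [p sp hp].
  by apply/mapP; exists p.
rewrite -[RHS]big_filter; apply: perm_big; apply: uniq_perm.
- by rewrite map_inj_in_uniq.
- by rewrite filter_uniq ?iota_uniq.
move=> j; rewrite mem_filter /=; case: (boolP (j \in map h s)) => //.
by case/mapP => p sp ->; rewrite mem_index_iota h_lt.
Qed.

(** * Monomial expansion of alternants and the action of [euler k] *)

Section Alternants.
Set Implicit Arguments.
Unset Strict Implicit.
Variable n : nat.
Implicit Types (mu nu : 'I_n -> nat) (lam : ypart n).

Lemma alternant_ext mu nu : mu =1 nu -> alternant mu = alternant nu.
Proof.
by move=> eq_mu; congr (\det _); apply/matrixP => i j; rewrite !mxE eq_mu.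
Qed.

Lemma alternant_neq0_inj mu : alternant mu != 0 -> injective mu.
Proof.
move=> nz i j eq_mu; apply/eqP; apply: contraNT nz => ne_ij.
rewrite /alternant -det_tr (determinant_alternate ne_ij) // => k.
by rewrite !mxE eq_mu.
Qed.

(** The Leibniz formula for the determinant, which reduces [euler k] to its action on monomials. *)
Lemma alternantE mu :
  alternant mu
    = \sum_(s : 'S_n) (-1) ^+ s *: 'X_[[multinom mu (s i) | i < n]].
Proof.
apply: eq_bigr => s _; rewrite -mul_mpolyC rmorph_sign; congr (_ * _).
by rewrite mpolyXE_id; apply: eq_bigr => i _; rewrite !mxE mnmE.
Qed.

Lemma euler_is_linear k : linear (@euler n k).
Proof.
move=> c p q; rewrite /euler scaler_sumr -big_split; apply: eq_bigr => i _ /=.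
by rewrite mderivD mderivZ mulrDr -scalerAr.
Qed.

HB.instance Definition _ k :=
  GRing.isLinear.Build rat {mpoly rat[n]} {mpoly rat[n]} _ (@euler n k)
    (euler_is_linear k).

Lemma eulerM k (p q : {mpoly rat[n]}) :
  euler k (p * q) = euler k p * q + p * euler k q.
Proof.
rewrite /euler mulr_suml mulr_sumr -big_split /=; apply: eq_bigr => i _.
by rewrite mderivM; ring.
Qed.

(** When [m i] is zero the subtraction is truncated, but the coefficient vanishes. *)
Lemma eulerX k (m : 'X_{1..n}) :
  euler k 'X_[m] = \sum_(i < n) (m i)%:R *: 'X_[(m - U_(i) + U_(i) *+ k)%MM].
Proof.
apply: eq_bigr => i _; rewrite mderivX mpolyXD -mpolyXn.
by rewrite [_ * 'X_i ^+ k]mulrC scalerAr.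
Qed.

(** In the term of [s], the variable of index [i] has exponent [mu (s i)]; reindexing by [j = s i]
    makes the shifted entry independent of [s], so the terms regroup into alternants. *)
Lemma euler_alternant k mu :
  euler k (alternant mu)
    = \sum_(j < n) (mu j)%:R
        *: alternant (fun i => mu i - (i == j) + (i == j) * k)%N.
Proof.
under [RHS]eq_bigr do rewrite alternantE scaler_sumr.
rewrite exchange_big alternantE linear_sum; apply: eq_bigr => s _ /=.
rewrite linearZ /= eulerX scaler_sumr [RHS](reindex_perm s) /=.
apply: eq_bigr => i _; rewrite !scalerA mulrC mnmE; congr (_ *: 'X_[_]).
by apply/mnmP => l; rewrite !mnmE mulmnE mnm1E (inj_eq perm_inj) eq_sym.
Qed.

(** Same reindexing: multiplying by ['X_i] raises the entry [s i] of [mu]. *)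
Lemma sumX_mul_alternant mu :
  (\sum_(i < n) 'X_i) * alternant mu
    = \sum_(j < n) alternant (fun i => mu i + (i == j))%N.
Proof.
under [RHS]eq_bigr do rewrite alternantE.
rewrite exchange_big alternantE mulr_sumr; apply: eq_bigr => s _ /=.
rewrite mulr_suml [RHS](reindex_perm s).
apply: eq_bigr => i _ /=; rewrite -scalerAr -mpolyXD; congr (_ *: 'X_[_]).
by apply/mnmP => l; rewrite !mnmE (inj_eq perm_inj) eq_sym addnC.
Qed.

(** * Strictly decreasing exponents and partitions *)

Lemma delta_lt (i j : 'I_n) : (i < j)%N -> (delta j < delta i)%N.
Proof. by move=> lt_ij; have := ltn_ord j; rewrite /delta; lia. Qed.

(* Shifting one entry of a strictly decreasing sequence keeps it weakly
   decreasing, so a nonzero alternant forces it to be strictly decreasing. *)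
Lemma ypart_of_alternant mu :
  (forall i j : 'I_n, (i < j)%N -> (mu j + delta j <= mu i + delta i)%N) ->
  alternant (fun i => mu i + delta i)%N != 0 ->
  exists nu : ypart n, forall i, tnth nu i = mu i.
Proof.
move=> mono /alternant_neq0_inj inj; apply: ypart_exists => i j lt_ij.
(* Each step to the right loses at least one, by injectivity. Over [d] places [delta] loses exactly
   [d], so [mu] itself does not increase. *)
have lt_chain (d : nat) : forall l : 'I_n, (l = i + d :> nat)%N ->
    (mu l + delta l + d <= mu i + delta i)%N.
  elim: d => [|d IHd] l El.
    by rewrite addn0 (_ : l = i) //; apply: val_inj; rewrite /= El addn0.
  have lt_d : (i + d < n)%N by have := ltn_ord l; lia.
  have := IHd (Ordinal lt_d) erefl.
  have := mono (Ordinal lt_d) l; rewrite El /= => /(_ ltac:(lia)).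
  have ne : Ordinal lt_d <> l by move/(congr1 val) => /=; lia.
  have : (mu (Ordinal lt_d) + delta (Ordinal lt_d) <> mu l + delta l)%N.
    by move/inj.
  lia.
have := lt_chain (j - i)%N j ltac:(lia); have := ltn_ord j.
by rewrite /delta; lia.
Qed.

(** * The cases k = 0, 1, 2 and their values on a_delta *)

Lemma euler0_alternant mu :
  euler 0 (alternant mu)
    = \sum_(j < n) (mu j)%:R *: alternant (fun i => mu i - (i == j))%N.
Proof.
rewrite euler_alternant; apply: eq_bigr => j _; congr (_ *: _).
by apply: alternant_ext => i; rewrite muln0 addn0.
Qed.

Lemma euler1_alternant mu :
  euler 1 (alternant mu) = (\sum_(j < n) mu j)%:R *: alternant mu.
Proof.
rewrite euler_alternant natr_sum scaler_suml; apply: eq_bigr => j _.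
(* Lowering and then raising an entry restores it only if it is positive; otherwise the coefficient
   is zero. *)
have [-> | pos] := posnP (mu j); first by rewrite !scale0r.
by congr (_ *: _); apply: alternant_ext => i; case: eqP => [->|_]; lia.
Qed.

Lemma euler2_alternant mu :
  euler 2 (alternant mu)
    = \sum_(j < n) (mu j)%:R *: alternant (fun i => mu i + (i == j))%N.
Proof.
rewrite euler_alternant; apply: eq_bigr => j _.
have [-> | pos] := posnP (mu j); first by rewrite !scale0r.
by congr (_ *: _); apply: alternant_ext => i; case: eqP => [->|_]; lia.
Qed.

Lemma euler0_delta : euler 0 (alternant (@delta n)) = 0.
Proof.
rewrite euler0_alternant big1 // => j _; case: (posnP (delta j)) => [-> | pos].
  by rewrite scale0r.
have lt_j : (j.+1 < n)%N by move: pos; rewrite /delta; lia.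
set a := alternant _; have [-> | nz] := eqVneq a 0; first by rewrite scaler0.
(* The lowered entry [delta j - 1] equals the next entry of [delta]. *)
have := @alternant_neq0_inj _ nz j (Ordinal lt_j).
rewrite eqxx -val_eqE /= /delta /= => /(_ ltac:(lia)) /(congr1 val) /=; lia.
Qed.

(** The raised entry collides with the preceding entry of [delta]. *)
Lemma alternant_bump_delta (j : 'I_n) :
  (0 < j)%N -> alternant (fun i => delta i + (i == j))%N = 0.
Proof.
move=> pos; set a := alternant _; have [//| nz] := eqVneq a 0.
have lt_j : (j.-1 < n)%N by have := ltn_ord j; lia.
have := @alternant_neq0_inj _ nz j (Ordinal lt_j).
have := ltn_ord j; rewrite eqxx -val_eqE /= /delta /= => lt_jn.
move=> /(_ ltac:(lia)) /(congr1 val) /=; lia.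
Qed.

(** Only [j = 0] survives on either side, and its coefficient is [delta 0 = n - 1]. *)
Lemma euler2_delta :
  euler 2 (alternant (@delta n))
    = n.-1%:R *: ((\sum_(i < n) 'X_i) * alternant (@delta n)).
Proof.
rewrite euler2_alternant sumX_mul_alternant scaler_sumr; apply: eq_bigr => j _.
have [j0 | j_gt0] := posnP j; first by rewrite {1}/delta j0 subn1.
by rewrite alternant_bump_delta // !scaler0.
Qed.

(** * Sums over cells as sums over rows *)

Lemma sum_added_cells (w : cell -> rat) lam :
  \sum_(p <- added_cells lam) w p.1 *: (schur_pol p.2 * alternant (@delta n))
    = \sum_(j < n) w (j : nat, tnth lam j)
        *: alternant (fun i => tnth lam i + delta i + (i == j))%N.
Proof.
pose G k := w (k, nth 0%N lam k)
  *: alternant (fun i : 'I_n => tnth lam i + delta i + (val i == k))%N.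
transitivity (\sum_(j < n) G j); last first.
  by apply: eq_bigr => j _; rewrite /G -tnth_nth.
apply: (@big_seq_image _ _ _ _ (fun p => p.1.1)).
- exact: added_cells_uniq.
- move=> [c mu] [c' mu'].
  rewrite !added_cellsP /= => /addsP[i -> muE] /addsP[i' -> mu'E] /= /val_inj ii'.
  subst i'; congr (_, _); apply/val_inj/eq_from_tnth => j.
  by rewrite muE mu'E.
- by move=> [c mu]; rewrite added_cellsP => /addsP[i -> _] /=.
- move=> [c mu]; rewrite added_cellsP => /addsP[i -> muE] /=.
  rewrite schur_polM /G -tnth_nth; congr (_ *: _); apply: alternant_ext => j.
  by rewrite muE val_eqE addnAC.
move=> j; rewrite scaler_eq0 negb_or => /andP[_ nz].
have [||mu muE] := @ypart_of_alternant (fun i => tnth lam i + (i == j))%N.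
(* The strict drop of [delta] absorbs the unit added to one row. *)
- move=> i l lt_il; have := delta_lt lt_il; have := ypart_anti _ lam _ _ (ltnW lt_il).
  by case: eqP; case: eqP; lia.
- rewrite (@alternant_ext _
    (fun i : 'I_n => tnth lam i + delta i + (val i == j))%N) => [|i].
    exact: nz.
  by rewrite addnAC.
exists ((j : nat, tnth lam j), mu) => //.
by rewrite added_cellsP; apply/addsP; exists j.
Qed.

(** Empty rows have to be excluded by hand: for the last row truncated subtraction would return the
    nonzero alternant of [lam + delta]. *)
Lemma sum_removed_cells (w : cell -> rat) lam :
  \sum_(p <- removed_cells lam) w p.1 *: (schur_pol p.2 * alternant (@delta n))
    = \sum_(j < n | (0 < tnth lam j)%N) w (j : nat, (tnth lam j).-1)
        *: alternant (fun i => tnth lam i + delta i - (i == j))%N.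
Proof.
pose G k := if (0 < nth 0 lam k)%N then w (k, (nth 0 lam k).-1)
  *: alternant (fun i : 'I_n => tnth lam i + delta i - (val i == k))%N else 0.
transitivity (\sum_(j < n) G j); last first.
  by rewrite [RHS]big_mkcond; apply: eq_bigr => j _; rewrite /G -tnth_nth.
apply: (@big_seq_image _ _ _ _ (fun p => p.1.1)).
- exact: removed_cells_uniq.
- move=> [c mu] [c' mu'].
  rewrite !removed_cellsP /= => /addsP[i -> muE] /addsP[i' -> mu'E] /= /val_inj ii'.
  subst i'; have eq_mu j : tnth mu j = tnth mu' j.
    by have := mu'E j; rewrite muE => /addIn.
  by rewrite eq_mu; congr (_, _); apply/val_inj/eq_from_tnth.
- by move=> [c mu]; rewrite removed_cellsP => /addsP[i -> _] /=.
- move=> [c mu]; rewrite removed_cellsP => /addsP[i -> muE] /=.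
  rewrite schur_polM /G -tnth_nth muE eqxx addn1 /=; congr (_ *: _).
  by apply: alternant_ext => j; rewrite muE val_eqE addnAC addnK.
move=> j; rewrite /G -tnth_nth; case: ifP => [pos|]; last by rewrite eqxx.
rewrite scaler_eq0 negb_or => /andP[_ nz].
have [||mu muE] := @ypart_of_alternant (fun i => tnth lam i - (i == j))%N.
- move=> i l lt_il; have := delta_lt lt_il; have := ypart_anti _ lam _ _ (ltnW lt_il).
  by case: eqP; case: eqP; lia.
- rewrite (@alternant_ext _
    (fun i : 'I_n => tnth lam i + delta i - (val i == j))%N) => [|i].
    exact: nz.
  by rewrite val_eqE; have [->|] := eqVneq i j; lia.
exists ((j : nat, (tnth lam j).-1), mu) => //.
rewrite removed_cellsP; apply/addsP; exists j => [|i]; rewrite muE.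
  by rewrite eqxx subn1.
by have [->|] := eqVneq i j; lia.
Qed.

(** * The operators on Schur polynomials *)

Lemma euler_schur k lam :
  euler k (schur_pol lam) * alternant (@delta n)
    = euler k (alternant (fun i => tnth lam i + delta i)%N)
      - schur_pol lam * euler k (alternant (@delta n)).
Proof. by rewrite -schur_polM eulerM addrK. Qed.

Lemma euler0_schur lam :
  euler 0 (schur_pol lam)
    = \sum_(p <- removed_cells lam)
        (n%:R + (content p.1)%:~R : rat) *: schur_pol p.2.
Proof.
apply: (mulIf (@alternant_delta_neq0 n)); rewrite euler_schur euler0_delta.
rewrite mulr0 subr0 mulr_suml; under [RHS]eq_bigr do rewrite -scalerAl.
rewrite (sum_removed_cells (fun c => n%:R + (content c)%:~R)) euler0_alternant.
rewrite [RHS]big_mkcond; apply: eq_bigr => j _.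
case: posnP => [lam_j0 | lam_j_gt0]; last first.
  (* The removed cell has column [tnth lam j - 1], so [n] plus its content is
     [tnth lam j + n - (j + 1)], the exponent in column [j]. *)
  congr (_ *: _); rewrite /content /= -[n%:R]/(n%:Z%:~R) -intrD.
  rewrite -[LHS]/((tnth lam j + delta j)%N%:Z%:~R); congr (_%:~R).
  by have := ltn_ord j; rewrite /delta; lia.
(* An empty row contributes nothing: either it is the last one and its exponent is zero, or the next
   row is empty too and two columns coincide. *)
set a := alternant _; have [-> | nz] := eqVneq a 0; first by rewrite scaler0.
rewrite lam_j0 add0n; have [-> | dj_gt0] := posnP (delta j).
  by rewrite scale0r.
have lt_j : (j.+1 < n)%N by move: dj_gt0; rewrite /delta; lia.
have := @ypart_anti _ lam j (Ordinal lt_j) (leqnSn j).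
rewrite lam_j0 leqn0 => /eqP lam_j1.
have := @alternant_neq0_inj _ nz j (Ordinal lt_j).
rewrite eqxx -val_eqE /= lam_j0 lam_j1 /delta /=.
by move=> /(_ ltac:(lia)) /(congr1 val) /=; lia.
Qed.

Lemma euler1_schur lam :
  euler 1 (schur_pol lam) = (psize lam)%:R *: schur_pol lam.
Proof.
apply: (mulIf (@alternant_delta_neq0 n)); rewrite euler_schur !euler1_alternant.
rewrite -schur_polM -scalerAr -scalerBl scalerAl; congr (_ *: _ * _).
by rewrite big_split natrD addrK.
Qed.

Lemma euler2_schur lam :
  euler 2 (schur_pol lam)
    = \sum_(p <- added_cells lam) ((content p.1)%:~R : rat) *: schur_pol p.2.
Proof.
apply: (mulIf (@alternant_delta_neq0 n)); rewrite euler_schur euler2_delta.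
(* Moving e_1 past [schur_pol lam] turns the correction into e_1 a_(lambda + delta), a sum of the
   same alternants as the main term. *)
rewrite -scalerAr mulrCA schur_polM euler2_alternant sumX_mul_alternant.
rewrite mulr_suml; under [RHS]eq_bigr do rewrite -scalerAl.
rewrite (sum_added_cells (fun c => (content c)%:~R)).
rewrite scaler_sumr -sumrB; apply: eq_bigr => j _.
(* The coefficient [tnth lam j + delta j - (n - 1)] equals [tnth lam j - j], the content of the
   added cell. *)
rewrite -scalerBl; congr (_ *: _); rewrite /content /=.
rewrite -[(_ + _)%:R]/((_ + _)%N%:Z%:~R) -[n.-1%:R]/(n.-1%:Z%:~R) -intrB.
by congr (_%:~R); have := ltn_ord j; rewrite /delta; lia.
Qed.

End Alternants.

Theorem theorem3 (n : nat) (hn : (1 <= n)%N) (lam : ypart n) :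
  [/\ Dminus (schur lam)
        = - \sum_(p <- removed_cells lam)
               (n%:R + (content p.1)%:~R : rat) *: schur p.2,
      Dzero (schur lam) = (2 * psize lam)%:R *: schur lam
    & Dplus (schur lam)
        = \sum_(p <- added_cells lam) ((content p.1)%:~R : rat) *: schur p.2].
Proof.
split.
- by congr (- _); apply: val_inj; rewrite [RHS]raddf_sum /= euler0_schur.
- by apply: val_inj; rewrite /= euler1_schur scalerA -natrM.
by apply: val_inj; rewrite [RHS]raddf_sum /= euler2_schur.
Qed.
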